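(* Let $p$ be an odd prime, $n\ge1$ an integer, and let $\mathcal{C}: y^2=Ax^3+Bx+C$ be an elliptic curve over $\mathbb{F}_{p^n}$. The trace of Frobenius of $\mathcal{C}$ satisfies the relation $$\tau_{p^n}(A,0,B,C)\equiv \sum_{l=\lceil\frac{p^n-1}{6}\rceil}^{\lfloor \frac{p^n-1}{4}\rfloor} \binom{\frac{p^n-1}{2}}{2l}\binom{2l}{\frac{p^n-1-2l}{2}}A^{\frac{p^n-1}{2}-l}B^{3l-\frac{p^n-1}{2}}C^{\frac{p^n-1}{2}-2l}\pmod{p}.$$
   Context: An elliptic curve $y^2=ax^3+bx^2+cx+d$ over $\mathbb{F}_q$ ($q$ odd) is a curve given by such an equation with $a\ne0,b,c,d\in\mathbb{F}_q$ and $ax^3+bx^2+cx+d$ having distinct roots. For such $a,b,c,d$, $\omega_q(a,b,c,d)$ denotes the complex number $\omega$, unique up to conjugation and chosen with nonnegative imaginary part, such that $|\omega|=\sqrt q$ and the elliptic curve $y^2=ax^3+bx^2+cx+d$ has exactly $q^m+1-\omega^m-\overline{\omega}^{\,m}$ points over $\mathbb{F}_{q^m}$ (point at infinity included) for all $m\ge1$. The trace of Frobenius is the integer $\tau_q(a,b,c,d):=\omega_q(a,b,c,d)+\overline{\omega_q(a,b,c,d)}$. The congruence modulo $p$ means equality in $\mathbb{F}_{p^n}$ of the image of the integer on the left with the element on the right; the convention $0^0=1$ is used. *)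

(* Defs.v *)
From HB Require Import structures.
From mathcomp Require Import all_boot all_order all_algebra all_field.
From mathcomp Require Import reals complex.

Set Implicit Arguments.
Unset Strict Implicit.
Unset Printing Implicit Defensive.
Import Order.TTheory GRing.Theory Num.Theory.
Local Open Scope ring_scope.

Definition cubic (F : nzRingType) (a b c d : F) : {poly F} :=
  a *: 'X^3 + b *: 'X^2 + c *: 'X + d%:P.

(* [separable_poly] is separability over every extension, i.e. the roots in an
   algebraic closure are pairwise distinct. *)
Definition elliptic (F : fieldType) (a b c d : F) : bool :=
  (a != 0) && separable_poly (cubic a b c d).

(* The successor accounts for the point at infinity. *)
Definition nb_points (K : finFieldType) (a b c d : K) : nat :=
  #|[set P : K * K | P.2 ^+ 2 == (cubic a b c d).[P.1]]|.+1.

(* [w] is omega_q(a, b, c, d), with q = #|F|. The field with q ^ m elements is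
   any finite field K of that cardinality; f embeds F in K. *)
Definition is_omega (R : realType) (F : finFieldType) (a b c d : F)
    (w : R[i]) : Prop :=
  [/\ `|w| = sqrtC (#|F|%:R), 0 <= 'Im w &
      forall (m : nat) (K : finFieldType) (f : {rmorphism F -> K}),
        (0 < m)%N -> #|K| = (#|F| ^ m)%N ->
        (nb_points (f a) (f b) (f c) (f d))%:R
          = #|F|%:R ^+ m + 1 - w ^+ m - (Num.conj w) ^+ m].

(* [t] is the trace of Frobenius tau_q(a, b, c, d), with q = #|F|, when [w] is
   omega_q(a, b, c, d). *)
Definition is_trace (R : realType) (w : R[i]) (t : int) : Prop :=
  t%:~R = w + Num.conj w.

Definition ceil_divn (m d : nat) : nat := ((m + d.-1) %/ d)%N.

(* Main.v *)
Require Import Defs.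
From mathcomp Require Import all_boot all_order all_algebra all_field.
From mathcomp Require Import reals complex.
From mathcomp Require Import cyclic zify ring.
Import Order.TTheory GRing.Theory Num.Theory.
Local Open Scope ring_scope.

(** Write q = 2h + 1 for the order of F and f = A x^3 + B x + C. Euler's
    criterion counts the square roots of v in F, modulo p, as 1 + v^h
    ([card_sqrt_finField]). Summing over v = f(x), the number of points of the
    curve over F becomes 1 + \sum_x f(x)^h in F, because q = 0 there. The trace
    is q + 1 minus this number, so it reduces to - \sum_x f(x)^h.

    The power sum \sum_x x^k vanishes in F unless k is a positive multiple of
    q - 1, when it is -1 ([sum_expr_finField]). The degree of f^h is
    3h < 2 (q - 1), so the only coefficient of f^h that survives the summation
    is that of x^(q-1), and the trace reduces to this coefficient
    ([natr_nb_points]).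

    Finally, expand f^h = (C + x (A x^2 + B))^h twice by the binomial theorem.
    The j-th power of x (A x^2 + B) has a term of the even degree q - 1 = 2h
    only if j = 2l is even, and this term takes A x^2 exactly h - l times. It
    exists when 2l <= h and h - l <= 2l, that is, h / 3 <= l <= h / 2, which
    gives the range of the sum ([coef_depressed_cubic_exp]). *)

Lemma finField_prim_root (F : finFieldType) :
  exists g : F, #|F|.-1.-primitive_root g.
Proof.
have q_gt1 : (1 < #|F|)%N := finNzRing_gt1 F.
pose rs := enum [pred x : F | x != 0].
have unity : all #|F|.-1.-unity_root rs.
  apply/allP => x; rewrite mem_enum inE unity_rootE => nz_x.
  apply/eqP/(mulIf nz_x); rewrite mul1r -exprSr prednK ?expf_card //.
  exact: ltnW.
have size_rs : (#|F|.-1 <= size rs)%N.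
  by rewrite -cardE (cardC1 (0 : F)).
have /hasP[g _ g_prim] : has #|F|.-1.-primitive_root rs.
  by apply: has_prim_root => //; [rewrite -subn1 subn_gt0 | exact: enum_uniq].
by exists g.
Qed.

(** Translation by 1 permutes F, so the sum of all elements is unchanged when
    #|F| ones are added to it. *)
Lemma natr_card_finField (F : finFieldType) : #|F|%:R = 0 :> F.
Proof.
apply: (addrI (\sum_(x : F) x)); rewrite addr0.
rewrite [RHS](reindex_inj (addIr 1)) big_split /=.
by rewrite sumr_const.
Qed.

(** For a generator g of the multiplicative group, multiplication by g permutes
    F, so the sum S satisfies g^k S = S: it vanishes unless g^k = 1. If
    g^k = 1 and k > 0, each of the #|F| - 1 nonzero elements contributes 1. For
    k = 0 the convention 0^0 = 1 adds the missing term, and the sum is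
    #|F| = 0. *)
Lemma sum_expr_finField (F : finFieldType) (k : nat) :
  \sum_(x : F) x ^+ k = if (0 < k)%N && (#|F|.-1 %| k)%N then -1 else 0.
Proof.
have q_gt0 : (0 < #|F|)%N := ltnW (finNzRing_gt1 F).
have [-> | k_gt0] := posnP k.
  rewrite (eq_bigr (fun=> 1)) => [|x _]; last exact: expr0.
  by rewrite sumr_const natr_card_finField.
have [g g_prim] := finField_prim_root F.
have g_nz : g != 0.
  apply: contra_eq_neq (prim_expr_order g_prim) => ->.
  by rewrite expr0n gtn_eqF ?(prim_order_gt0 g_prim) // eq_sym oner_neq0.
rewrite (prim_order_dvd g_prim) /=; case: eqP => [gk1 | /eqP gk_neq1].
  rewrite (bigD1 0) //= expr0n gtn_eqF // add0r.
  rewrite (eq_bigr (fun=> 1)) => [|x nz_x].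
    rewrite sumr_const (cardC1 (0 : F)) -subn1 natrB // natr_card_finField.
    by rewrite sub0r.
  have xq1 : x ^+ #|F|.-1 = 1.
    by apply: (mulIf nz_x); rewrite mul1r -exprSr prednK ?expf_card.
  have [i ->] := prim_rootP g_prim xq1.
  by rewrite exprAC gk1 expr1n.
rewrite -subr_eq0 in gk_neq1; apply: (mulfI gk_neq1); rewrite mulr0; apply/eqP.
rewrite mulrBl mul1r subr_eq0 mulr_sumr; apply/eqP.
rewrite [RHS](reindex_inj (mulfI g_nz)) /=.
by apply: eq_bigr => x _; rewrite exprMn.
Qed.

(** The size bound excludes every multiple of #|F| - 1 but 0 and #|F| - 1 from
    the exponents of f; the constant term contributes a multiple of #|F|. *)
Lemma sum_horner_finField (F : finFieldType) (f : {poly F}) :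
  (size f <= #|F|.-1.*2)%N -> \sum_(x : F) f.[x] = - f`_(#|F|.-1).
Proof.
move=> size_f; have q_gt1 : (1 < #|F|)%N := finNzRing_gt1 F.
under eq_bigr => x _ do rewrite (horner_coef_wide x size_f).
have lt_q : (#|F|.-1 < #|F|.-1.*2)%N by case: #|F| q_gt1 => [|[|q]] //= _; lia.
rewrite exchange_big (bigD1 (Ordinal lt_q)) //= -mulr_sumr.
rewrite sum_expr_finField dvdnn.
rewrite ifT; last by rewrite -subn1 subn_gt0 q_gt1.
rewrite mulrN1 big1 ?addr0 // => i ne_i.
rewrite -mulr_sumr sum_expr_finField ifF ?mulr0 //.
apply/negP => /andP[i_gt0 /dvdnP[[|[|c]] def_i]].
- by rewrite def_i in i_gt0.
- by case/eqP: ne_i; apply: val_inj; rewrite /= def_i mul1n.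
by have := ltn_ord i; rewrite def_i !mulSn addnA addnn ltnNge leq_addr.
Qed.

(** Euler's criterion in counting form. A nonzero square has two roots and a
    power v^h equal to 1; a nonsquare has no root, and v^h is 1 or -1. It cannot
    be 1: with v = g^i for a generator g, this would force 2h to divide ih, so
    that i would be even and v a square. *)
Lemma card_sqrt_finField (F : finFieldType) (h : nat) (v : F) :
  #|F| = h.*2.+1 -> #|[set y : F | y ^+ 2 == v]|%:R = 1 + v ^+ h :> F.
Proof.
move=> card_F.
have h_gt0 : (0 < h)%N by have := finNzRing_gt1 F; rewrite card_F; lia.
(* In characteristic 2, #|F| = 2h + 1 would be both 0 and 1 in F. *)
have two_nz : 2%:R != 0 :> F.
  apply/eqP => two0; have := natr_card_finField F.
  rewrite card_F -addn1 natrD -muln2 natrM two0 mulr0 add0r => /eqP.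
  by rewrite oner_eq0.
have unity (u : F) : u != 0 -> u ^+ h.*2 = 1.
  by move=> nz_u; apply: (mulIf nz_u); rewrite mul1r -exprSr -card_F expf_card.
have [-> | nz_v] := eqVneq v 0.
  rewrite expr0n gtn_eqF // addr0 (_ : [set _ | _] = [set 0]) ?cards1 //.
  by apply/setP => y; rewrite !inE expf_eq0.
have [/existsP[u /eqP def_v] | /existsPn no_root] :=
    boolP [exists u : F, u ^+ 2 == v].
  have nz_u : u != 0 by apply: contraNneq nz_v => u0; rewrite -def_v u0 expr0n.
  rewrite -def_v -exprM mul2n unity // (_ : [set _ | _] = [set u; - u]).
    rewrite cards2 (_ : (u != - u) = true) //.
    by rewrite -subr_eq0 opprK -mulr2n -mulr_natr mulf_neq0.
  by apply/setP => y; rewrite !inE eqf_sqr.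
rewrite (_ : [set _ | _] = set0); last first.
  by apply/setP => y; rewrite !inE; apply/negbTE.
rewrite cards0; have := sqrf_eq1 (v ^+ h).
rewrite -exprM muln2 unity // eqxx => /esym/orP[/eqP vh1 | /eqP ->]; last first.
  by rewrite subrr.
have [g g_prim] := finField_prim_root F.
rewrite card_F /= in g_prim.
have [[i lt_i] /= def_v] := prim_rootP g_prim (unity v nz_v).
have : (h.*2 %| i * h)%N by rewrite (prim_order_dvd g_prim) exprM -def_v vh1.
rewrite -mul2n dvdn_pmul2r // => /dvdnP[j def_i].
by case/eqP: (no_root (g ^+ j)); rewrite def_v def_i exprM.
Qed.

(** The 1 is the point at infinity; the affine points are counted fibrewise over
    the x-coordinate by Euler's criterion. *)
Lemma natr_nb_points (F : finFieldType) (h : nat) (a b c d : F) :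
  #|F| = h.*2.+1 ->
  (nb_points a b c d)%:R = 1 - (cubic a b c d ^+ h)`_(h.*2) :> F.
Proof.
move=> card_F; rewrite /nb_points -addn1 natrD addrC; congr (_ + _).
set f := cubic a b c d.
have h_gt0 : (0 < h)%N by have := finNzRing_gt1 F; rewrite card_F; lia.
have size_f : (size f <= 4)%N.
  apply/leq_sizeP => j j_ge4; rewrite !coefD !coefZ !coefXn coefX coefC.
  by case: j j_ge4 => [|[|[|[|j]]]] //= _; rewrite !mulr0 !addr0.
have size_fh : (size (f ^+ h) <= #|F|.-1.*2)%N.
  apply: leq_trans (size_poly_exp_leq _ _) _; rewrite card_F /=.
  have size_f' : ((size f).-1 <= 3)%N by case: (size f) size_f.
  by apply: leq_ltn_trans (leq_mul size_f' (leqnn h)) _; lia.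
transitivity (\sum_(x : F) (1 + f.[x] ^+ h)).
  rewrite -sum1_card natr_sum.
  transitivity (\sum_(x : F) \sum_(y : F | y ^+ 2 == f.[x]) (1 : F)).
    by rewrite pair_big_dep /=; apply: eq_bigl => P; rewrite inE.
  apply: eq_bigr => x _; rewrite -(card_sqrt_finField _ _ _ card_F).
  by rewrite -sum1_card natr_sum; apply: eq_bigl => y; rewrite inE.
rewrite big_split sumr_const /= natr_card_finField add0r.
under eq_bigr => x _ do rewrite -horner_exp.
by rewrite sum_horner_finField // card_F.
Qed.

Lemma sum_even_nat (V : nmodType) (G : nat -> V) (m : nat) :
  \sum_(j < m) (if odd j then 0 else G j./2) = \sum_(0 <= l < uphalf m) G l.
Proof.
elim: m => [|m IHm]; first by rewrite big_ord0 big_geq.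
rewrite big_ord_recr IHm /= uphalf_half.
case odd_m: (odd m); first by rewrite addr0.
by rewrite add0n big_nat_recr.
Qed.

Lemma coef_linear_exp (R : comNzRingType) (A B : R) (j k : nat) :
  ((A *: 'X + B%:P) ^+ j)`_k = A ^+ k * B ^+ (j - k) *+ 'C(j, k).
Proof.
rewrite addrC exprDn coef_sum.
transitivity (\sum_(i < j.+1)
    if i == k :> nat then A ^+ k * B ^+ (j - k) *+ 'C(j, k) else 0).
  apply: eq_bigr => i _.
  rewrite coefMn -rmorphXn coefCM exprZn coefZ coefXn eq_sym.
  case: eqP => [-> | _]; first by rewrite mulr1 mulrC.
  by rewrite !mulr0 mul0rn.
rewrite -big_mkcond /=; have [lt_jk | le_kj] := ltnP j k.
  by rewrite bin_small // big1.
have lt_kj : (k < j.+1)%N by [].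
by rewrite (big_pred1 (Ordinal lt_kj)) // => i.
Qed.

(** Once the factor X^j is removed, what remains is a polynomial in X^2, namely
    (A Y + B)^j at Y = X^2, and its coefficient at 2h - j is required. The bound
    on j keeps the truncated difference h - j/2 exact. *)
Lemma coef_expr_odd_cubic (R : comNzRingType) (A B : R) (h j : nat) :
  (j <= h)%N ->
  (('X * (A *: 'X^2 + B%:P)) ^+ j)`_(h.*2) =
    if odd j then 0 else
      A ^+ (h - j./2) * B ^+ (j - (h - j./2)) *+ 'C(j, h - j./2).
Proof.
move=> le_jh.
have -> : A *: 'X^2 + B%:P = (A *: 'X + B%:P) \Po 'X^2.
  by rewrite comp_polyD comp_polyZ comp_polyX comp_polyC.
rewrite exprMn -rmorphXn coefXnM ifF; last by lia.
rewrite coef_comp_poly_Xn // dvdn2 oddB ?odd_double /=; last by lia.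
case: ifPn => [even_j | /negPn odd_j]; last by rewrite odd_j.
have -> : ((h.*2 - j) %/ 2 = h - j./2)%N by lia.
by rewrite (negbTE even_j) coef_linear_exp.
Qed.

(** Binomial expansion around C. The lower bound on l expresses h - l <= 2l:
    below it the second binomial coefficient is zero. *)
Lemma coef_depressed_cubic_exp (R : comNzRingType) (A B C : R) (h : nat) :
  (cubic A 0 B C ^+ h)`_(h.*2) =
  \sum_(ceil_divn h 3 <= l < h./2.+1)
     ('C(h, l.*2) * 'C(l.*2, h - l))%:R *
     A ^+ (h - l) * B ^+ (3 * l - h) * C ^+ (h - l.*2).
Proof.
have -> : cubic A 0 B C = C%:P + 'X * (A *: 'X^2 + B%:P).
  rewrite /cubic scale0r addr0 addrC mulrDr -scalerAr -exprS; congr (_ + (_ + _)).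
  by rewrite mulrC mul_polyC.
pose G l := ('C(h, l.*2) * 'C(l.*2, h - l))%:R *
     A ^+ (h - l) * B ^+ (3 * l - h) * C ^+ (h - l.*2).
rewrite exprDn coef_sum.
transitivity (\sum_(j < h.+1) (if odd j then 0 else G j./2)).
  apply: eq_bigr => j _; have le_jh : (j <= h)%N by rewrite -ltnS.
  rewrite coefMn -rmorphXn coefCM coef_expr_odd_cubic //.
  case: ifP => [|even_j]; first by rewrite mulr0 mul0rn.
  rewrite /G; have -> : j./2.*2 = j by lia.
  have -> : (3 * j./2 - h = j - (h - j./2))%N by lia.
  rewrite mulrnAr -mulrnA -!mulrA mulr_natl mulnC; congr (_ *+ _).
  by rewrite mulrC mulrA.
rewrite sum_even_nat /= -/G (big_cat_nat (n := ceil_divn h 3)) //=; last first.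
  by rewrite /ceil_divn; lia.
rewrite [X in X + _]big_nat big1 ?add0r // => l /andP[_ lt_l].
rewrite /G (bin_small (n := l.*2)) ?muln0 ?mul0r //.
by move: lt_l; rewrite /ceil_divn; lia.
Qed.

Theorem lemma3p7 (R : realType) (p n : nat) (F : finFieldType) (A B C : F)
    (w : R[i]) :
  prime p -> odd p -> (0 < n)%N -> #|F| = (p ^ n)%N ->
  elliptic A 0 B C ->
  is_omega A 0 B C w ->
  exists2 t : int, is_trace w t &
    t%:~R =
    \sum_(ceil_divn (p ^ n - 1) 6 <= l < ((p ^ n - 1) %/ 4).+1)
      ('C((p ^ n - 1) %/ 2, 2 * l) *
       'C(2 * l, (p ^ n - 1 - 2 * l) %/ 2))%:R *
      A ^+ ((p ^ n - 1) %/ 2 - l) *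
      B ^+ (3 * l - (p ^ n - 1) %/ 2) *
      C ^+ ((p ^ n - 1) %/ 2 - 2 * l) :> F.
Proof.
move=> _ odd_p n_gt0 card_F _ [_ _ points_w].
pose h := (p ^ n)./2.
have def_q : (p ^ n = h.*2.+1)%N.
  have odd_q : odd (p ^ n) by rewrite oddX odd_p orbT.
  by rewrite /h; lia.
rewrite def_q in card_F *.
have N_w : (nb_points A 0 B C)%:R = #|F|%:R ^+ 1 + 1 - w ^+ 1 - Num.conj w ^+ 1.
  by apply: (points_w 1%N F idfun); rewrite ?expn1.
exists (#|F|%:Z + 1 - (nb_points A 0 B C)%:Z).
  rewrite /is_trace rmorphB rmorphD /= -!pmulrn N_w !expr1.
  by ring.
rewrite rmorphB rmorphD /= -!pmulrn natr_card_finField.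
rewrite (natr_nb_points _ _ _ _ _ _ card_F) coef_depressed_cubic_exp.
have -> : (h.*2.+1 - 1 = h.*2)%N by lia.
have -> : (h.*2 %/ 2 = h)%N by lia.
have -> : (h.*2 %/ 4 = h./2)%N by lia.
have -> : ceil_divn h.*2 6 = ceil_divn h 3 by rewrite /ceil_divn; lia.
rewrite add0r opprB addrC subrK.
apply: eq_big_nat => l _; rewrite !mul2n.
by have -> : ((h.*2 - l.*2) %/ 2 = h - l)%N by lia.
Qed.
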